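(* Let $D$ be an integral domain and let $\{S_\lambda\mid\lambda\in\Lambda\}$ be a locally finite defining family of overrings (respectively, of $t$-flat overrings) of $D$. If each $S_\lambda$ is a Mori (respectively, strong Mori) domain, then $D$ is a Mori (respectively, strong Mori) domain.
   Context: Let $D$ be an integral domain with quotient field $K$. An overring of $D$ is a ring between $D$ and $K$. A family $\{S_\lambda\}$ of overrings is a defining family of $D$ if $D=\bigcap_\lambda S_\lambda$; it is locally finite if every nonzero element of $D$ is a unit in all but finitely many of the $S_\lambda$. For nonzero $D$-submodules $E$ of $K$: $(D:E)=\{x\in K\mid xE\subseteq D\}$, $E^v=(D:(D:E))$ (with $(D:0)=K$); $E^t=\bigcup\{F^v\mid F\subseteq E,\ F\text{ nonzero finitely generated}\}$; $E^w=\bigcup\{(E:J)\mid J\text{ nonzero finitely generated ideal of }D\text{ with }J^v=D\}$, where $(E:J)=\{x\in K\mid xJ\subseteq E\}$. A nonzero ideal $I$ of $D$ is a $v$- (resp. $t$-, $w$-) ideal if $I^v=I$ (resp. $I^t=I$, $I^w=I$). $D$ is Mori if it satisfies the ascending chain condition on (integral) $v$-ideals, and strong Mori if it satisfies the ascending chain condition on (integral) $w$-ideals. A maximal $t$-ideal is a maximal element among proper $t$-ideals (it is a prime ideal). An overring $S$ of $D$ is $t$-flat over $D$ if $S_M=D_{M\cap D}$ for each maximal $t$-ideal $M$ of $S$. *)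

(* Defs.v *)
From HB Require Import structures.
From mathcomp Require Import all_boot all_order all_algebra.
From mathcomp Require Import boolp classical_sets cardinality.

Set Implicit Arguments.
Unset Strict Implicit.
Unset Printing Implicit Defensive.

Import GRing.Theory.
Local Open Scope classical_set_scope.
Local Open Scope ring_scope.

(* A domain with quotient field K is represented as a subring D of the field K
   such that every element of K is a fraction of elements of D. All overrings
   and submodules are then subsets of the same field K. *)

Section Domains.
Variable K : fieldType.
Implicit Types D S E F I J M P : set K.

Definition is_subring D : Prop := subring_closed [in D].

Definition has_quotient_field D : Prop :=
  is_subring D /\
  forall x : K, exists a b : K, [/\ D a, D b, b != 0 & x = a / b].

Definition overring D S : Prop := is_subring S /\ D `<=` S.

Definition defining_family D (Lambda : Type) (S : Lambda -> set K) : Prop :=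
  D = \bigcap_l S l.

Definition is_unit S (x : K) : Prop := S x /\ exists2 y, S y & x * y = 1.

Definition locally_finite D (Lambda : Type) (S : Lambda -> set K) : Prop :=
  forall x : K, D x -> x != 0 -> finite_set [set l | ~ is_unit (S l) x].

Definition submodule D E : Prop :=
  [/\ E 0,
      forall x y, E x -> E y -> E (x + y)
    & forall a x, D a -> E x -> E (a * x)].

Definition nonzero E : Prop := exists2 x, E x & x != 0.

Definition is_ideal D I : Prop := submodule D I /\ I `<=` D.

Definition span_over D (s : seq K) : set K :=
  [set x | exists2 c : 'I_(size s) -> K,
     forall i, D (c i) & x = \sum_(i < size s) c i * s`_i].

Definition fin_gen D E : Prop := exists s : seq K, E = span_over D s.

Definition colon E J : set K := [set x | forall y, J y -> E (x * y)].

Definition v_closure D E : set K := colon D (colon D E).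

Definition t_closure D E : set K :=
  [set x | exists F, [/\ fin_gen D F, nonzero F, F `<=` E & v_closure D F x]].

Definition w_closure D E : set K :=
  [set x | exists J,
     [/\ is_ideal D J, fin_gen D J, nonzero J, v_closure D J = D
       & colon E J x]].

Definition v_ideal D I : Prop :=
  [/\ is_ideal D I, nonzero I & v_closure D I = I].

Definition t_ideal D I : Prop :=
  [/\ is_ideal D I, nonzero I & t_closure D I = I].

Definition w_ideal D I : Prop :=
  [/\ is_ideal D I, nonzero I & w_closure D I = I].

Definition acc (C : set K -> Prop) : Prop :=
  forall I : nat -> set K,
    (forall n, C (I n)) -> (forall n, I n `<=` I n.+1) ->
    exists N, forall n, (N <= n)%N -> I n = I N.

Definition Mori D : Prop := acc (v_ideal D).

Definition strong_Mori D : Prop := acc (w_ideal D).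

Definition maximal_t_ideal D M : Prop :=
  [/\ t_ideal D M, M <> D
    & forall I, t_ideal D I -> I <> D -> M `<=` I -> I = M].

(* Used only for P prime: then 0 belongs to P, so the denominators are nonzero
   and the convention 0^-1 = 0 plays no role. *)
Definition localization D P : set K :=
  [set x | exists a b : K, [/\ D a, D b, ~ P b & x = a / b]].

Definition t_flat D S : Prop :=
  forall M, maximal_t_ideal S M ->
    localization S M = localization D (M `&` D).

End Domains.

(* Main.v *)
(** An ideal of [D] containing a finite family [s] with [(D : s) = D] is called
    dense. Dense ideals satisfy Gabriel's transitivity axiom, and [x] lies in
    the w-closure of [I] iff [(I :_D x)] is dense.

    An ascending chain of v-ideals [I_n] of [D] induces in each [S_l] the chain
    of the v-closures; some nonzero [x] of [I_0] is a unit in all but finitely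
    many [S_l], so all these chains are constant from a common index [N] on,
    whence [(D : I_n) = (D : I_N)] for [n >= N].

    For w-ideals the same common index exists for the chains [(I_n S_l)^w].
    Let [x] be in [I_n] with [n >= N]. If [A = (I_N :_D x)] were not dense in
    [S_l], it would lie in a maximal t-ideal [M] of [S_l], and t-flatness would
    put [x] in the localization of [I_N] at [M `&` D], i.e. give an element of
    [A] outside [M]. So [A] is dense in every [S_l], by local finiteness it is
    dense in [D], and [x] is in [I_N]. *)
Require Import Defs.
From mathcomp Require Import all_boot all_order all_algebra.
From mathcomp Require Import boolp classical_sets cardinality.

Set Implicit Arguments.
Unset Strict Implicit.
Unset Printing Implicit Defensive.

Import GRing.Theory.
Local Open Scope classical_set_scope.
Local Open Scope ring_scope.

(** * Submodules, finite spans and v-closures over a subring of [K] *)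

Section Subrings.
Variables (K : fieldType) (D : set K).
Hypothesis ringD : is_subring D.

Lemma subring1 : D 1.
Proof. by case: ringD => + _ _; rewrite in_setE. Qed.

Lemma subringB x y : D x -> D y -> D (x - y).
Proof.
by case: ringD => _ + _ => /(_ x y); rewrite !in_setE.
Qed.

Lemma subringM x y : D x -> D y -> D (x * y).
Proof.
by case: ringD => _ _ /(_ x y); rewrite !in_setE.
Qed.

Lemma subring0 : D 0.
Proof. by rewrite -(subrr 1); exact: subringB subring1 subring1. Qed.

Lemma subringD x y : D x -> D y -> D (x + y).
Proof.
move=> Dx Dy; rewrite -[y]opprK -[- y]sub0r.
by apply: subringB => //; apply: subringB => //; exact: subring0.
Qed.

Lemma submodule_sum E n (F : 'I_n -> K) :
  submodule D E -> (forall i, E (F i)) -> E (\sum_(i < n) F i).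
Proof. by case=> E0 ED _ EF; apply: big_ind. Qed.

Lemma submodule_colon E (J : set K) : submodule D E -> submodule D (colon E J).
Proof.
case=> E0 ED EM; split=> [y _|x y Ex Ey z Jz|a x Da Ex y Jy].
- by rewrite mul0r.
- by rewrite mulrDl; apply: ED; [exact: Ex|exact: Ey].
- by rewrite -mulrA; apply: EM => //; exact: Ex.
Qed.

Lemma submodule_self : submodule D D.
Proof.
split=> [|x y|a x]; [exact: subring0|exact: subringD|exact: subringM].
Qed.

Lemma span_sub E s : submodule D E -> (forall z, z \in s -> E z) ->
  span_over D s `<=` E.
Proof.
move=> smE Es x [c Dc ->]; apply: submodule_sum => // i.
by case: (smE) => _ _; apply=> //; exact/Es/mem_nth.
Qed.

Lemma mem_span s z : z \in s -> span_over D s z.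
Proof.
move=> sz; have lts : (index z s < size s)%N by rewrite index_mem.
exists (fun i => (i == Ordinal lts)%:R).
  by move=> i; case: (i == _); [exact: subring1|exact: subring0].
rewrite (bigD1 (Ordinal lts)) //= eqxx mul1r nth_index// big1 ?addr0// => i.
by move=> /negbTE ->; rewrite mul0r.
Qed.

Lemma submodule_span s : submodule D (span_over D s).
Proof.
split=> [|_ _ [c Dc ->] [d Dd ->]|a _ Da [c Dc ->]].
- exists (fun=> 0); first by move=> _; exact: subring0.
  by rewrite big1 // => i _; rewrite mul0r.
- exists (fun i => c i + d i); first by move=> i; exact: subringD.
  by rewrite -big_split; apply: eq_bigr => i _; rewrite mulrDl.
- exists (fun i => a * c i); first by move=> i; exact: subringM.
  by rewrite mulr_sumr; apply: eq_bigr => i _; rewrite mulrA.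
Qed.

Lemma span_colon E y s : submodule D E -> (forall z, z \in s -> E (y * z)) ->
  colon E (span_over D s) y.
Proof.
move=> smE ys z sz; rewrite mulrC.
apply: (span_sub (submodule_colon [set y] smE) _ sz) => // u us _ ->.
by rewrite mulrC; exact: ys.
Qed.

Lemma v_closure_subset E : E `<=` v_closure D E.
Proof. by move=> x Ex y /(_ x Ex); rewrite mulrC. Qed.

Lemma colon_v_closure E : colon D (v_closure D E) = colon D E.
Proof.
apply/seteqP; split=> y Ey z Ez; first exact/Ey/v_closure_subset.
by rewrite mulrC; apply: Ez.
Qed.

Lemma v_closure_sub_ring E : E `<=` D -> v_closure D E `<=` D.
Proof.
by move=> ED x /(_ 1); rewrite mulr1; apply=> y Ey; rewrite mul1r; exact: ED.
Qed.

Lemma v_ideal_v_closure E : nonzero E -> E `<=` D ->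
  v_ideal D (v_closure D E).
Proof.
move=> [x Ex x0] ED; split.
- split; last exact: v_closure_sub_ring.
  exact: submodule_colon submodule_self.
- by exists x => //; exact: v_closure_subset.
- by rewrite {1}/v_closure colon_v_closure.
Qed.

Lemma ideal_unit (I : set K) x : is_ideal D I -> I x -> is_unit D x -> I = D.
Proof.
move=> [[_ _ IM] ID] Ix [Dx [y Dy xy1]]; apply/seteqP; split=> // d Dd.
have -> : d = d * y * x by rewrite -mulrA (mulrC y) xy1 mulr1.
by apply: IM => //; exact: subringM.
Qed.

(** The t-closure asks for a nonzero finitely generated submodule, while [s] may be empty or zero. A
    nonzero [e] of [E] is therefore prepended to [s]; this can only enlarge the v-closure of the
    span. *)
Lemma t_closure_span E x s : (forall z, z \in s -> E z) -> submodule D E ->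
  nonzero E -> v_closure D (span_over D s) x -> t_closure D E x.
Proof.
move=> Es smE [e Ee e0] vx; exists (span_over D (e :: s)); split.
- by exists (e :: s).
- by exists e => //; apply: mem_span; rewrite mem_head.
- by apply: span_sub => // z; rewrite inE => /predU1P[->//|/Es].
- move=> y ys; apply: vx => z sz; apply: ys; apply: span_sub sz.
    exact: submodule_span.
  by move=> u us; apply: mem_span; rewrite inE us orbT.
Qed.

End Subrings.

(** * Dense sets, w-closures and maximal t-ideals *)

Section Dense.
Variables (K : fieldType) (D : set K).
Hypothesis ringD : is_subring D.

(* Glaz-Vasconcelos ideals, i.e. the [J] with [J^v = D], given by generators.
   If [D = K], the empty list qualifies, so that every set is dense. *)
Definition gv_list (s : seq K) : Prop :=
  (forall z, z \in s -> D z) /\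
  forall y, (forall z, z \in s -> D (y * z)) -> D y.

Definition dense (A : set K) : Prop :=
  exists2 s, gv_list s & forall z, z \in s -> A z.

Definition residual (A : set K) (x : K) : set K :=
  [set d | D d /\ A (x * d)].

Lemma dense_subset A B : A `&` D `<=` B -> dense A -> dense B.
Proof.
move=> AB [s [sD gs] sA]; exists s => // z sz.
by apply: AB; split; [exact: sA|exact: sD].
Qed.

(** The witness consists of the products [z * u], with [z] in the list for [B] and [u] in the list
    [T z] for the residual at [z]. If [y] sends all of them into [D], then [T z] gives [y * z] in
    [D] for each [z], and the list for [B] gives [y] in [D]. *)
Lemma dense_gabriel A B : dense B -> (forall b, B b -> dense (residual A b)) ->
  dense A.
Proof.
move=> [s [sD gs] sB] H.
have /choice[T HT] : forall z, exists t, z \in s ->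
    gv_list t /\ forall u, u \in t -> residual A z u.
  move=> z; have [zs|zs] := boolP (z \in s); last by exists [::].
  by have [t gt tA] := H z (sB z zs); exists t.
exists [seq z * u | z <- s, u <- T z].
  split=> [_ /allpairsPdep[z [u [zs uT ->]]]|y yD].
    by apply: subringM => //; [exact: sD|case: (HT z zs) => -[+ _] _; apply].
  apply: gs => z zs; have [[_ gT] _] := HT z zs; apply: gT => u uT.
  by rewrite -mulrA; apply: yD; apply/allpairsPdep; exists z, u.
by move=> _ /allpairsPdep[z [u [zs uT ->]]]; have [_ /(_ u uT)[]] := HT z zs.
Qed.

Lemma denseT A : A 1 -> dense A.
Proof.
move=> A1; exists [:: 1]; last by move=> z; rewrite inE => /eqP ->.
split=> [z|y yD]; first by rewrite inE => /eqP ->; exact: subring1.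
by rewrite -[y]mulr1; apply: yD; rewrite mem_head.
Qed.

Lemma dense_residual_sub A x : A `<=` D -> dense (residual A x) -> D x.
Proof. by move=> AD [s [_ gs] sA]; apply: gs => z /sA[_ /AD]. Qed.

Lemma gv_list_v_closure s : gv_list s -> v_closure D (span_over D s) = D.
Proof.
move=> [sD gs]; have smD := submodule_self ringD.
apply/seteqP; split; first by apply: v_closure_sub_ring; exact: span_sub.
move=> d Dd y ys; apply: subringM => //; apply: gs => z zs.
exact/ys/mem_span.
Qed.

Lemma w_closureE I : is_ideal D I -> nonzero I ->
  w_closure D I = [set x | dense (residual I x)].
Proof.
move=> [smI ID] [i Ii i0]; have smD := submodule_self ringD.
apply/seteqP; split=> x.
  move=> [J [[_ JD] [s JE] _ vJ xJ]]; rewrite {}JE in JD vJ xJ; exists s.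
    split=> [z zs|y ys]; first exact/JD/mem_span.
    have : v_closure D (span_over D s) 1 by rewrite vJ; exact: subring1.
    by move=> /(_ y); rewrite mul1r; apply; exact: span_colon.
  by move=> z zs; split; [exact/JD/mem_span|exact/xJ/mem_span].
move=> rx; have Dx := dense_residual_sub ID rx.
have [s [sD gs] sI] := rx.
have gis : gv_list (i :: s).
  split=> [z|y ys]; first by rewrite inE => /predU1P[->|/sD//]; exact: ID.
  by apply: gs => z zs; apply: ys; rewrite inE zs orbT.
exists (span_over D (i :: s)); split.
- by split; [exact: submodule_span|exact: span_sub gis.1].
- by exists (i :: s).
- by exists i => //; apply: mem_span; rewrite // mem_head.
- exact: gv_list_v_closure.
- apply: span_colon => // z; rewrite inE => /predU1P[->|/sI[]//].
  by case: smI => _ _; apply.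
Qed.

(** Additivity and idempotence of the w-closure both come from Gabriel's axiom. *)
Lemma w_ideal_w_closure I : is_ideal D I -> nonzero I ->
  w_ideal D (w_closure D I).
Proof.
move=> idI nzI; have [[I0 IA IM] ID] := idI; have [i Ii i0] := nzI.
have IW : I `<=` w_closure D I.
  rewrite w_closureE// => x Ix; apply: denseT; split; first exact: subring1.
  by rewrite mulr1.
have idW : is_ideal D (w_closure D I).
  rewrite w_closureE//; split; last by move=> x; exact: dense_residual_sub.
  split=> [|x y rx ry|a x Da].
  - by apply: denseT; split; [exact: subring1|rewrite mul0r].
  - apply: dense_gabriel rx _ => b [Db Ib]; apply: dense_subset ry.
    move=> d [[_ Id] Dd]; split=> //; split; first exact: subringM.
    rewrite mulrDl mulrA; apply: IA; first by rewrite mulrC; exact: IM.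
    by rewrite mulrCA; exact: IM.
  - apply: dense_subset => d [[Dd Ix] _]; split=> //.
    by rewrite -mulrA; exact: IM.
split=> //; first by exists i => //; exact: IW.
rewrite [LHS]w_closureE//; last by exists i => //; exact: IW.
apply/seteqP; split=> [x|x Wx].
  rewrite {2}w_closureE// => rx; apply: dense_gabriel rx _ => b [Db].
  rewrite w_closureE//; apply: dense_subset => d [[Dd Id] _].
  by split=> //; split; [exact: subringM|rewrite mulrA].
by apply: denseT; split; [exact: subring1|rewrite mulr1].
Qed.

(** Density is witnessed by a finite list, so it passes from the union of a chain to one member. The
    first alternative takes care of the empty chain. *)
Lemma seq_sub_chain (F : set (set K)) (A : set K) (s : seq K) :
  total_on F subset ->
  (forall z, z \in s -> ((\bigcup_(X in F) X) `|` A) z) ->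
  (forall z, z \in s -> A z) \/
  exists2 X, F X & forall z, z \in s -> (X `|` A) z.
Proof.
move=> totF; elim: s => [|a s IHs] sU; first by left.
have {IHs}[z zs||[X FX sX]] := IHs.
- by apply: sU; rewrite inE zs orbT.
- move=> sA; case: (sU a (mem_head _ _)) => [[Y FY Ya]|Aa].
    right; exists Y => // z; rewrite inE => /predU1P[->|/sA]; first by left.
    by right.
  by left=> z; rewrite inE => /predU1P[->|/sA].
- right; case: (sU a (mem_head _ _)) => [[Y FY Ya]|Aa]; last first.
    by exists X => // z; rewrite inE => /predU1P[->|/sX//]; right.
  have [XY|YX] := totF X Y FX FY.
    exists Y => // z; rewrite inE => /predU1P[->|/sX[/XY|]]; first by left.
      by left.
    by right.
  by exists X => // z; rewrite inE => /predU1P[->|/sX//]; left; exact: YX.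
Qed.

Lemma maximal_not_dense A : A `<=` D -> ~ dense A ->
  exists M, [/\ A `<=` M, M `<=` D, ~ dense M &
    forall B, M `<=` B -> B `<=` D -> ~ dense B -> B `<=` M].
Proof.
move=> AD nA.
(* The empty chain must have its union in the family, so non-density is imposed on the union of [X]
   with [A] rather than asking [X] to contain [A]. *)
have [F FP totF|M0 [[M0D nM] maxM]] :=
    @Zorn_bigcup _ [set X | X `<=` D /\ ~ dense (X `|` A)].
  split=> [z [X /FP[XD _] Xz]|[s gs sU]]; first exact: XD.
  have [sA|[X FX sX]] := seq_sub_chain totF sU; first by apply: nA; exists s.
  by have [_] := FP X FX; apply; exists s.
exists (M0 `|` A); split=> // [x []|B MB BD nB]; [exact: M0D|exact: AD|].
have BA : B `|` A = B by apply/setUidPl => x Ax; apply: MB; right.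
apply: contrapT => nBM; apply: (maxM B); last by split=> //; rewrite BA.
split; first by move=> x Mx; apply: MB; left.
by move=> BM; apply: nBM => x /BM; left.
Qed.

(** The last hypothesis puts [x] in the v-closure of the span of [f]. In a GV list, [x] can then be
    traded for the elements of [f], so adjoining [x] to [M] cannot create density. *)
Lemma maximal_not_dense_closed M x (f : seq K) :
  M `<=` D -> ~ dense M ->
  (forall B, M `<=` B -> B `<=` D -> ~ dense B -> B `<=` M) ->
  D x -> (forall z, z \in f -> M z) ->
  (forall y, (forall z, z \in f -> D (y * z)) -> D (y * x)) -> M x.
Proof.
move=> MD nM maxM Dx fM fx.
apply: (maxM (M `|` [set x])); [by left|by move=> z [/MD|->]| |by right].
move=> [s [sD gs] sMx]; apply: nM.
have sM : forall z, z \in [seq z <- s | `[< M z >]] ++ f -> M z.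
  by move=> z; rewrite mem_cat mem_filter => /orP[/andP[/asboolP]|/fM].
exists ([seq z <- s | `[< M z >]] ++ f) => //.
split=> [z /sM/MD//|y ysf]; apply: gs => z zs; case: (sMx z zs) => [Mz|->].
  apply: ysf; rewrite mem_cat mem_filter zs andbT.
  by apply/orP; left; apply/asboolP.
by apply: fx => u uf; apply: ysf; rewrite mem_cat uf orbT.
Qed.

(** A maximal non-dense [M] is closed under v-closures of its finite subsets, hence is a t-ideal. It
    is maximal as such because a dense t-ideal contains 1. It is prime because if [a] and [b] were
    outside [M], adjoining either would give a dense set, and Gabriel's axiom would make [M]
    dense. *)
Lemma exists_maximal_t_ideal A : A `<=` D -> nonzero A -> ~ dense A ->
  exists M, [/\ maximal_t_ideal D M, A `<=` M, ~ dense M &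
    forall a b, D a -> D b -> M (a * b) -> M a \/ M b].
Proof.
move=> AD [e Ae e0] nA.
have [M [AM MD nM maxM]] := maximal_not_dense AD nA.
have clM := maximal_not_dense_closed MD nM maxM.
have MM a x : D a -> M x -> M (a * x).
  move=> Da Mx; apply: (clM _ [:: x]); first by apply: subringM => //; exact: MD.
    by move=> z; rewrite inE => /eqP ->.
  move=> y yx; rewrite mulrCA; apply: subringM => //; apply: yx.
  exact: mem_head.
have nzM : nonzero M by exists e => //; exact: AM.
have idM : is_ideal D M.
  split=> //; split=> // [|x y Mx My].
    by rewrite -(mul0r e); apply: MM; [exact: subring0|exact: AM].
  apply: (clM _ [:: x; y]); first by apply: subringD => //; exact: MD.
    by move=> z; rewrite !inE => /orP[] /eqP ->.
  move=> z zxy; rewrite mulrDr.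
  by apply: subringD => //; apply: zxy; rewrite !inE eqxx ?orbT.
have tM : t_ideal D M.
  split=> //; apply/seteqP; split=> x.
    move=> [F [[f FE] _ fM vx]]; rewrite {}FE in fM vx; apply: (clM _ f).
    - by apply: v_closure_sub_ring vx => // z /fM/MD.
    - by move=> z zf; apply/fM/mem_span.
    - move=> y yf; rewrite mulrC; apply: vx.
      by apply: span_colon => //; exact: submodule_self.
  move=> Mx; apply: (@t_closure_span _ _ _ _ _ [:: x]) => //.
  - by move=> z; rewrite inE => /eqP ->.
  - by case: idM.
  - by apply: v_closure_subset; apply: mem_span => //; rewrite mem_head.
exists M; split=> //.
  split=> //.
    by move=> MeqD; apply: nM; rewrite MeqD; apply: denseT; exact: subring1.
  move=> I [[smI ID] nzI tI] ID' MI; apply/seteqP; split=> //.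
  apply: maxM => // -[s gs sI]; apply: ID'.
  have I1 : I 1.
    rewrite -tI; apply: (@t_closure_span _ _ _ _ _ s) => //.
    by rewrite gv_list_v_closure //; exact: subring1.
  apply: (@ideal_unit _ _ ringD _ 1) => //.
  split; first exact: subring1.
  by exists 1; [exact: subring1|rewrite mulr1].
move=> a b Da Db Mab; apply: contrapT => nab.
have dns c : D c -> ~ M c -> dense (M `|` [set c]).
  move=> Dc nMc; apply: contrapT => nMc'; apply: nMc.
  by apply: (maxM (M `|` [set c])); [by left|by move=> z [/MD|->]| |by right].
have nMa : ~ M a by move=> Ma; apply: nab; left.
have nMb : ~ M b by move=> Mb; apply: nab; right.
apply: nM; apply: dense_gabriel (dns a Da nMa) _ => c cMa.
apply: dense_subset (dns b Db nMb) => d [dMb Dd]; split=> //.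
case: cMa => [Mc|->]; first by rewrite mulrC; exact: MM.
by case: dMb => [Md|->] //; exact: MM.
Qed.

End Dense.

(** * Extension of ideals to a t-flat overring *)

Section Extension.
Variables (K : fieldType) (D S : set K).
Hypothesis ringS : is_subring S.

(** This is the product [I S], encoded by its minimality instead of by finite sums. *)
Definition extension (I : set K) : set K :=
  \bigcap_(E in [set E | submodule S E /\ I `<=` E]) E.

Lemma sub_extension I : I `<=` extension I.
Proof. by move=> x Ix E [_]; apply. Qed.

Lemma extension_min I E : submodule S E -> I `<=` E -> extension I `<=` E.
Proof. by move=> smE IE x; apply. Qed.

Lemma submodule_extension I : submodule S (extension I).
Proof.
split=> [E [[]//]|x y Ix Iy E IE|a x Sa Ix E IE].
- by have [[_ ED _] _] := IE; apply: ED; [exact: Ix|exact: Iy].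
- by have [[_ _ EM] _] := IE; apply: EM => //; exact: Ix.
Qed.

Lemma ideal_extension I : I `<=` S -> is_ideal S (extension I).
Proof.
move=> IS; split; first exact: submodule_extension.
by apply: extension_min => //; exact: submodule_self.
Qed.

Hypotheses (ringD : is_subring D) (DS : D `<=` S) (flatS : t_flat D S).

(* If the conductor were not dense, t-flatness at a maximal t-ideal [M]
   containing it would make [{z | b z \in I for some b in D outside M}] an
   [S_M]-module, and this module contains [x]. *)
Lemma t_flat_dense_residual (I : set K) x :
  submodule D I -> I `<=` D -> nonzero I -> D x ->
  w_closure S (extension I) x -> dense S (residual D I x).
Proof.
move=> [I0 ID IM] subID [i Ii i0] Dx; apply: contraPP => nd.
have [||M [maxM AM nM primeM]] := exists_maximal_t_ideal ringS _ _ nd.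
- by move=> d [/DS].
- by exists i => //; split; [exact: subID|exact: IM].
have locM c j : S c -> S j -> ~ M j ->
    exists a b, [/\ D a, D b, ~ M b, b != 0 & c / j = a / b].
  move=> Sc Sj nMj; have : localization S M (c / j) by exists c, j.
  rewrite (flatS maxM) => -[a [b [Da Db nMb ->]]].
  have nMb' : ~ M b by move=> Mb; exact: nMb.
  exists a, b; split=> //; apply: contra_notN nMb' => /eqP ->.
  by case: maxM => -[[[]]].
pose T := [set z | exists b, [/\ D b, ~ M b & I (b * z)]].
have nM1 : ~ M 1 by move=> M1; apply: nM; exact: denseT.
have primeD a b : D a -> D b -> ~ M a -> ~ M b -> ~ M (a * b).
  by move=> /DS Sa /DS Sb nMa nMb /(primeM _ _ Sa Sb)[].
(* By t-flatness [c / j] has a denominator in [D] outside [M], which can be absorbed into the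
   multiplier [b]. *)
have TZ c j z : S c -> S j -> ~ M j -> T z -> T (c / j * z).
  move=> Sc Sj nMj [b [Db nMb Ibz]].
  have [a [b' [Da Db' nMb' b'0 ->]]] := locM c j Sc Sj nMj.
  exists (b' * b); split; [exact: subringM|exact: primeD|].
  have -> : b' * b * (a / b' * z) = a * (b * z).
    by rewrite mulrACA (mulrCA b') mulfV // mulr1.
  exact: IM.
have smT : submodule S T.
  split=> [|y z [b [Db nMb Iby]] [c [Dc nMc Icz]]|a z Sa Tz].
  - by exists 1; split=> //; [exact: subring1|rewrite mulr0].
  - exists (b * c); split; [exact: subringM|exact: primeD|].
    rewrite mulrDr; apply: ID; last by rewrite -mulrA; exact: IM.
    by rewrite mulrAC mulrC; exact: IM.
  - by rewrite -[a]divr1; apply: TZ => //; exact: subring1.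
have IT : extension I `<=` T.
  apply: extension_min => // z Iz; exists 1; split=> //; first exact: subring1.
  by rewrite mul1r.
have IS : I `<=` S by move=> z /subID/DS.
rewrite w_closureE //; [|exact: ideal_extension|]; last first.
  by exists i => //; exact: sub_extension.
move=> [s gs sI].
(* Since [M] is not dense, some entry [j] of the GV list avoids it; [x * j] is in [T], and dividing
   by [j] puts [x] in [T]. *)
have [j js nMj] : exists2 j, j \in s & ~ M j.
  apply: contrapT => sM; apply: nM; exists s => // j js.
  by apply: contrapT => nMj; apply: sM; exists j.
have [Sj /IT Txj] := sI j js.
have j0 : j != 0.
  by apply: contra_notN nMj => /eqP ->; case: maxM => -[[[]]].
have := TZ 1 j _ (subring1 ringS) Sj nMj Txj.
rewrite mul1r mulrCA mulVf // mulr1 => -[b [Db nMb Ibx]].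
by apply: nMb; apply: AM; split; rewrite // mulrC.
Qed.

End Extension.

(** * Consequences of local finiteness *)

Section LocallyFinite.
Variables (K : fieldType) (D : set K) (Lambda : Type) (S : Lambda -> set K).
Hypothesis hfin : locally_finite D S.

Lemma locally_finite_exceptions x : D x -> x != 0 ->
  exists s : seq {classic Lambda},
    forall l : {classic Lambda}, l \in s \/ is_unit (S l) x.
Proof.
move=> Dx x0.
have /(@finite_seqP {classic Lambda})[s sE] := hfin Dx x0.
exists s => l; have [ux|nux] := pselect (is_unit (S l) x); first by right.
by left; have : [set l | ~ is_unit (S l) x] l by []; rewrite sE.
Qed.

(** Where [x] is a unit, every [W l n] is all of [S l]. Only finitely many chains remain, and the
    maximum of their indices of stabilization serves for all. *)
Lemma uniform_acc (C : set K -> set K -> Prop) (W : Lambda -> nat -> set K) x :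
  (forall l, is_subring (S l)) -> D x -> x != 0 ->
  (forall l, acc (C (S l))) ->
  (forall l n, C (S l) (W l n) /\ is_ideal (S l) (W l n)) ->
  (forall l n, W l n `<=` W l n.+1) -> (forall l n, W l n x) ->
  exists N, forall l n, (N <= n)%N -> W l n = W l N.
Proof.
move=> ringS Dx x0 accS CW Wmono Wx.
have [s sP] := locally_finite_exceptions Dx x0.
have /choice[f fP] : forall l : {classic Lambda},
    exists N, forall n, (N <= n)%N -> W l n = W l N.
  by move=> l; apply: (accS l (W l)) => n; [case: (CW l n)|exact: Wmono].
exists (\max_(l <- s) f l) => l n Nn; have [ls|ux] := sP l.
  have fN : (f l <= \max_(l <- s) f l)%N by exact: leq_bigmax_seq.
  by rewrite (fP l n) ?(fP l _ fN) // (leq_trans fN Nn).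
have WS m : W l m = S l.
  by apply: (ideal_unit (ringS l) _ (Wx l m) ux); case: (CW l m).
by rewrite !WS.
Qed.

(** The witness is a nonzero [a] of [A] together with the GV lists of the finitely many [S l] where
    [a] is not a unit. In the other [S l], [y * a] in [S l] already forces [y] in [S l]. *)
Lemma dense_of_dense_overrings (A : set K) :
  defining_family D S -> (forall l, is_subring (S l)) -> A `<=` D ->
  nonzero A -> (forall l, dense (S l) A) -> dense D A.
Proof.
move=> hdef ringS AD [a Aa a0] dA.
have [s sP] := locally_finite_exceptions (AD _ Aa) a0.
have /choice[f fP] : forall l : {classic Lambda},
    exists t, gv_list (S l) t /\ forall z, z \in t -> A z.
  by move=> l; have [t gt tA] := dA l; exists t.
have inA z : z \in a :: flatten [seq f l | l <- s] -> A z.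
  by rewrite inE => /predU1P[->//|/flatten_mapP[l _ zf]]; apply: (fP l).2.
exists (a :: flatten [seq f l | l <- s]) => //.
split=> [z /inA/AD//|y yD]; rewrite hdef => l _.
have yS z : z \in a :: flatten [seq f l | l <- s] -> S l (y * z).
  by move/yD; rewrite hdef; apply.
have [ls|[_ [b Sb ab1]]] := sP l.
  apply: (fP l).1.2 => z zf; apply: yS; rewrite inE; apply/orP; right.
  by apply/flatten_mapP; exists l.
rewrite -[y]mulr1 -ab1 mulrA; apply: subringM => //; apply: yS.
exact: mem_head.
Qed.

End LocallyFinite.

(** * Stabilization of chains of v-ideals and of w-ideals in [D] *)

Lemma chain_subset (T : Type) (I : nat -> set T) :
  (forall n, I n `<=` I n.+1) -> forall m n, (m <= n)%N -> I m `<=` I n.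
Proof.
move=> Imono m n /subnK <-; elim: (n - m)%N => // k IHk.
by rewrite addSn; apply: subset_trans IHk (Imono _).
Qed.

Theorem corollary4p6 (K : fieldType) (D : set K)
    (hD : has_quotient_field D)
    (Lambda : Type) (S : Lambda -> set K)
    (hover : forall l : Lambda, overring D (S l))
    (hdef : defining_family D S)
    (hfin : locally_finite D S) :
  ((forall l : Lambda, Mori (S l)) -> Mori D) /\
  ((forall l : Lambda, t_flat D (S l)) ->
   (forall l : Lambda, strong_Mori (S l)) -> strong_Mori D).
Proof.
have [ringD _] := hD.
have ringS l : is_subring (S l) by case: (hover l).
have DS l : D `<=` S l by case: (hover l).
split.
  move=> moriS I vI Imono.
  have IS l n : I n `<=` S l by case: (vI n) => -[_ ID] _ _ z /ID; apply: DS.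
  have Isub := chain_subset Imono.
  have [[_ ID0] [x I0x x0] _] := vI 0%N.
  have Ix n : I n x by exact: Isub I0x.
  have vW l n : v_ideal (S l) (v_closure (S l) (I n)).
    by apply: v_ideal_v_closure => //; exists x.
  have [||N NP] := uniform_acc hfin (C := @v_ideal K)
      (W := fun l n => v_closure (S l) (I n))
      ringS (ID0 _ I0x) x0 moriS _ _ (fun l n => v_closure_subset (Ix n)).
  - by move=> l n; split=> //; case: (vW l n).
  - by move=> l n z vz y yI; apply: vz => u Iu; apply/yI/Imono.
  exists N => n Nn; apply/seteqP; split; last exact: Isub.
  have [_ _ <-] := vI N; have [_ _ <-] := vI n.
  (* It suffices that [y] in [(D : I N)] multiplies [I n] into each [S l]; it multiplies [I N]
     there, hence also the v-closure of [I N] over [S l], which contains [I n]. *)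
  move=> z vz y yN; apply: vz => u Iu; rewrite hdef => l _.
  have : v_closure (S l) (I N) u by rewrite -(NP l n Nn); exact: v_closure_subset.
  by move=> /(_ y); rewrite mulrC; apply=> w Iw; exact/DS/yN.
move=> flatS moriS I wI Imono.
have ID n : I n `<=` D by case: (wI n) => -[].
have IS l n : I n `<=` S l by move=> z /ID/DS.
have Isub := chain_subset Imono.
have [_ [x I0x x0] _] := wI 0%N.
have Ix n : I n x by exact: Isub I0x.
pose E l n := extension (S l) (I n).
have idE l n : is_ideal (S l) (E l n) by exact: ideal_extension.
have Ex l n : E l n x by exact: sub_extension.
have nzE l n : nonzero (E l n) by exists x.
have wW l n : w_ideal (S l) (w_closure (S l) (E l n)).
  exact: w_ideal_w_closure.
have EW l n : E l n `<=` w_closure (S l) (E l n).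
  move=> z Ez; rewrite w_closureE //; apply: denseT => //.
  by split; [exact: subring1|rewrite mulr1].
have [||N NP] := uniform_acc hfin (C := @w_ideal K)
    (W := fun l n => w_closure (S l) (E l n))
    ringS (ID _ _ I0x) x0 moriS _ _ (fun l n => EW l n x (Ex l n)).
- by move=> l n; split=> //; case: (wW l n).
- move=> l n z; rewrite !w_closureE //; apply: dense_subset.
  move=> d [[Sd Ed] _]; split=> //; apply: extension_min Ed.
    exact: submodule_extension.
  by apply: subset_trans (Imono n) _; exact: sub_extension.
exists N => n Nn; apply/seteqP; split; last exact: Isub.
move=> z Iz; have [idN nzN <-] := wI N.
have [smN _] := idN; have Dz := ID _ _ Iz.
rewrite w_closureE //; apply: (dense_of_dense_overrings hfin) => //.
- by move=> d [].
- by exists x => //; split; [exact: (ID N)|case: smN => _ _; apply].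
(* The common index enters here: [z] in [I n] lies in the w-closure of [E l n], which equals that of
   [E l N]. *)
- move=> l; apply: t_flat_dense_residual => //.
  by rewrite -(NP l n Nn); apply: EW; exact: sub_extension.
Qed.
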